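(* Let $T>0$, let $\Omega\subset\mathbb{R}^N$ be a nonempty open set, let $f=f(t,x)\colon [0,T]\times\Omega\to\mathbb{R}^N$ be continuous, and let $G$ be an open and bounded set with $\overline{G}\subset\Omega$. Let $(V_{u})_{u\in \partial G}$ be a family of non-degenerate bounding functions for $G$ such that $$\langle f(t,u), \nabla V_{u}(u)\rangle \leq 0, \quad \text{for all } u\in \partial G \text{ and } t\in [0,T],$$ and suppose that there exists a continuous function $g \colon \partial G\to \mathbb{R}^{N}$ such that $$\sup_{u\in \partial G}\langle g(u), \nabla V_{u}(u)\rangle < 0.$$ If $\overline{G}$ is homeomorphic to a closed ball of $\mathbb{R}^{N}$, then there exists a $T$-periodic solution of $\dot{y}=f(t,y)$ with values in $\overline{G}$.
   Context: $\langle\cdot,\cdot\rangle$ and $\|\cdot\|$ are the Euclidean inner product and norm; $B(u,r)$ is the open ball with center $u$ and radius $r$. A family of bounding functions for an open bounded set $G$ is a family $(V_u)_{u\in\partial G}$ such that for each $u\in\partial G$ there is a radius $r_u>0$ for which $V_u\colon B(u,r_u)\to\mathbb{R}$ is a $\mathcal{C}^1$-function with $V_u(u)=0$ and $G\cap B(u,r_u)\subset\{x\in B(u,r_u)\colon V_u(x)<0\}$. The family is called non-degenerate if there are constants $0<\eta^-\leq\eta^+$ such that $\eta^-\leq\|\nabla V_u(u)\|\leq\eta^+$ for all $u\in\partial G$. A $T$-periodic solution of $\dot y=f(t,y)$ with values in $\overline{G}$ is a solution $y$ defined on $[0,T]$ such that $y(0)=y(T)$ and $y(t)\in\overline{G}$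 for all $t\in[0,T]$. Uniqueness of solutions of initial value problems is not assumed. *)

(* Defs.v *)
From HB Require Import structures.
From mathcomp Require Import all_boot all_order all_algebra.
From mathcomp Require Import all_classical all_reals all_analysis.

Set Implicit Arguments.
Unset Strict Implicit.
Unset Printing Implicit Defensive.

Import Order.TTheory GRing.Theory Num.Theory.
Import numFieldNormedType.Exports.

Local Open Scope classical_set_scope.
Local Open Scope ring_scope.

(* The library norm `|x| and ball x r on 'rV[R]_N are those of the max norm;
   they give the usual topology and the usual bounded sets, but the norm and
   the balls that occur in the bounding-function conditions are Euclidean. *)
Definition edot (R : realType) (N : nat) (u v : 'rV[R]_N) : R :=
  \sum_(i < N) u ord0 i * v ord0 i.

Definition enorm (R : realType) (N : nat) (u : 'rV[R]_N) : R :=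
  Num.sqrt (edot u u).

Definition eball (R : realType) (N : nat) (c : 'rV[R]_N) (r : R) :
    set 'rV[R]_N :=
  [set x | enorm (x - c) < r].

Definition eclosed_ball (R : realType) (N : nat) (c : 'rV[R]_N) (r : R) :
    set 'rV[R]_N :=
  [set x | enorm (x - c) <= r].

Definition boundary (X : topologicalType) (A : set X) : set X :=
  closure A `\` interior A.

Definition grad (R : realType) (N : nat) (V : 'rV[R]_N -> R)
    (x : 'rV[R]_N) : 'rV[R]_N :=
  \row_(i < N) 'D_(delta_mx ord0 i) V x.

(* Meant for open D: then neither conjunct depends on the values of V
   outside D, so that V encodes a function with domain D. *)
Definition C1_on (R : realType) (N : nat) (D : set 'rV[R]_N)
    (V : 'rV[R]_N -> R) : Prop :=
  (forall x, D x -> differentiable V x) /\ {within D, continuous (grad V)}.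

(* V u stands for V_u; it is constrained only for u in the boundary of G, and
   there only on the ball of radius r_u around u. *)
Definition bounding_family (R : realType) (N : nat) (G : set 'rV[R]_N)
    (V : 'rV[R]_N -> 'rV[R]_N -> R) : Prop :=
  forall u, boundary G u ->
    exists r : R, [/\ 0 < r,
      C1_on (eball u r) (V u),
      V u u = 0 &
      G `&` eball u r `<=` [set x | eball u r x /\ V u x < 0]].

Definition nondegenerate_family (R : realType) (N : nat) (G : set 'rV[R]_N)
    (V : 'rV[R]_N -> 'rV[R]_N -> R) : Prop :=
  exists eta1 eta2 : R, [/\ 0 < eta1, eta1 <= eta2 &
    forall u, boundary G u ->
      eta1 <= enorm (grad (V u) u) /\ enorm (grad (V u) u) <= eta2].

Definition homeomorphic (X Y : topologicalType) (A : set X) (B : set Y) :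
    Prop :=
  exists (h : X -> Y) (k : Y -> X),
    [/\ {within A, continuous h} /\ {within B, continuous k},
        (forall x, A x -> B (h x)), (forall y, B y -> A (k y)),
        (forall x, A x -> k (h x) = x) & (forall y, B y -> h (k y) = y)].

(* The derivative is the limit of difference quotients within [0, T], hence
   one-sided at 0 and T. *)
Definition is_solution (R : realType) (N : nat) (T : R) (Omega : set 'rV[R]_N)
    (f : R -> 'rV[R]_N -> 'rV[R]_N) (y : R -> 'rV[R]_N) : Prop :=
  forall t : R, `[0, T]%classic t ->
    Omega (y t) /\
    (s - t)^-1 *: (y s - y t) @[s --> within `[0, T]%classic t^'] --> f t (y t).

Definition is_periodic_solution_in (R : realType) (N : nat) (T : R)
    (Omega : set 'rV[R]_N) (f : R -> 'rV[R]_N -> 'rV[R]_N)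
    (K : set 'rV[R]_N) (y : R -> 'rV[R]_N) : Prop :=
  [/\ is_solution T Omega f y, y 0 = y T &
      forall t : R, `[0, T]%classic t -> K (y t)].

(* Main.v *)
(* If the inequality at the boundary is strict, uniformly in u, then by uniform
   continuity a single explicit Euler step, of small enough size, of a point of
   G cannot cross the boundary: at the first exit point u the function V_u would
   decrease along the step from positive values, whereas V_u < 0 on G near u.
   Hence small Euler steps map the closure of G continuously into itself.
   Perturbing f to f + eps g, with g extended continuously by Tietze's theorem,
   makes the inequality strict, and Brouwer's theorem on the closure of G yields
   a T-periodic Euler orbit.  Letting eps and the step size tend to 0 gives the
   periodic solution; uniqueness of initial value problems plays no role.

   Brouwer's theorem comes from a discrete Stokes formula: for 0/1-labels u_i on
   the grid {0..m}^n which are 0 where x_i = 0 and 1 where x_i = m, the sum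
   modulo 2 over all unit cubes of the cup product of the coboundaries of the
   u_i is determined by the boundary and equals 1, so that some unit cube
   carries both values of every label. *)

Require Import Defs.
From HB Require Import structures.
From mathcomp Require Import all_boot all_order all_algebra.
From mathcomp Require Import all_classical all_reals all_analysis.
From mathcomp Require Import lra ring.

Set Implicit Arguments.
Unset Strict Implicit.
Unset Printing Implicit Defensive.

Import Order.TTheory GRing.Theory Num.Theory.
Import numFieldNormedType.Exports.

Local Open Scope classical_set_scope.
Local Open Scope ring_scope.

(** * Brouwer's theorem *)

Section CharTwo.
Variable F : comNzRingType.
Hypothesis char2 : 2%N \in [pchar F].

Lemma addrr_char2 (a : F) : a + a = 0.
Proof. exact: addrr_pchar2. Qed.

Lemma eq_addr_char2 (a b : F) : a + b = 0 -> a = b.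
Proof. by move/eqP; rewrite addr_eq0 (oppr_pchar2 char2) => /eqP. Qed.

Lemma exchange_setD1 (I : finType) (V : nmodType) (D : {set I})
    (E : I -> I -> V) :
  \sum_(j in D) \sum_(k in D :\ j) E j k =
  \sum_(j in D) \sum_(k in D :\ j) E k j.
Proof.
rewrite (exchange_big_dep (mem D)) /=; last by move=> j k _ /setD1P[].
apply: eq_bigr => j jD; apply: eq_bigl => k.
by rewrite !inE jD andbT andbC eq_sym.
Qed.

(** The terms of [(j, k)] and [(k, j)] are equal and cancel in characteristic 2, as when a
    coboundary is taken twice. *)
Lemma sum_sym_char2 n (D : {set 'I_n}) (f : 'I_n -> 'I_n -> F) :
  (forall j k, f j k = f k j) ->
  \sum_(j in D) \sum_(k in D :\ j) f j k = 0.
Proof.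
move=> Fs.
under eq_bigr => j _ do rewrite (bigID (fun k : 'I_n => (k < j)%N)) /=.
rewrite big_split /=; set A := (X in X + _); set B := (X in _ + X).
suff -> : B = A by rewrite addrr_char2.
rewrite /B (exchange_big_dep (mem D)) /=; last by move=> j k _ /andP[/setD1P[]].
apply: eq_bigr => j jD; apply: eq_big => k; last by rewrite Fs.
rewrite !inE jD andbT -leqNgt ltn_neqAle -(inj_eq val_inj) eq_sym.
by case: (k \in D); rewrite ?andbF //= andbT andbA andbb.
Qed.

Section Grid.
Variable n : nat.
Implicit Types (x y : 'I_n -> nat) (D : {set 'I_n}) (i j k : 'I_n) (us : seq 'I_n).
Variable u : 'I_n -> ('I_n -> nat) -> F.

Definition gstep j x : 'I_n -> nat := fun i => (x i + (i == j))%N.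

Definition gset j (c : nat) x : 'I_n -> nat := fun i => if i == j then c else x i.

Lemma gstepC j k x : gstep j (gstep k x) = gstep k (gstep j x).
Proof. by apply/funext => i; rewrite /gstep addnAC. Qed.

Lemma gsetC j k a b x : j != k -> gset j a (gset k b x) = gset k b (gset j a x).
Proof.
move=> jk; apply/funext => i; rewrite /gset.
by case: (eqVneq i j) jk => // -> /negbTE ->.
Qed.

Lemma gstep_gset j c x : gstep j (gset j c x) = gset j c.+1 x.
Proof.
by apply/funext => i; rewrite /gstep /gset; case: eqP; rewrite ?addn1 ?addn0.
Qed.

Lemma gstep_gsetC j k c x : j != k -> gstep j (gset k c x) = gset k c (gstep j x).
Proof.
move=> jk; apply/funext => i; rewrite /gstep /gset.
by case: (eqVneq i k) => // ->; rewrite eq_sym (negbTE jk) addn0.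
Qed.

(* The value on the cube with lower corner [x] and edge directions [D] of the
   cup product of the coboundaries of [u i], [i] in [us].  In characteristic 2
   no signs are needed. *)
Fixpoint cup us D x : F :=
  if us is i :: us' then
    \sum_(j in D) (u i (gstep j x) + u i x) * cup us' (D :\ j) (gstep j x)
  else 1.

Lemma setD1C D j k : D :\ j :\ k = D :\ k :\ j.
Proof. by apply/setP => i; rewrite !inE andbCA. Qed.

(* A cup product of coboundaries is a cocycle. *)
Lemma cup_closed us D x :
  \sum_(j in D) (cup us (D :\ j) (gstep j x) + cup us (D :\ j) x) = 0.
Proof.
elim: us D x => [|i us IH] D x /=; first by rewrite big1 // => j _; rewrite addrr_char2.
pose w j k y := cup us (D :\ j :\ k) y.
have wC j k y : w j k y = w k j y by rewrite /w setD1C.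
(* Expansion into four double sums. The first is symmetric and cancels. With [j] and [k] exchanged,
   the third joins the second, and their sum over [k] is the induction hypothesis at [gstep j x].
   The fourth becomes symmetric by the same hypothesis. *)
transitivity (\sum_(j in D) \sum_(k in D :\ j)
  (u i (gstep k (gstep j x)) * w j k (gstep k (gstep j x)) +
   (u i (gstep j x) * w j k (gstep k (gstep j x)) +
    u i (gstep k x) * w j k (gstep k x)) + u i x * w j k (gstep k x))).
  apply: eq_bigr => j jD; rewrite -big_split; apply: eq_bigr => k kD /=.
  by rewrite -/(w j k _) -/(w j k _) !mulrDl !addrA.
under eq_bigr => j _ do rewrite !big_split /=.
rewrite !big_split /= sum_sym_char2 ?add0r; last first.
  by move=> j k; rewrite wC gstepC.
rewrite [X in _ + X + _]exchange_setD1 -big_split /= big1 ?add0r; last first.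
  move=> j jD; under eq_bigr => k _ do [].
  under [X in _ + X]eq_bigr => k _ do rewrite wC.
  rewrite -big_split /=.
  under eq_bigr => k _ do rewrite -mulrDr.
  by rewrite -mulr_sumr IH mulr0.
rewrite exchange_setD1.
transitivity (u i x * \sum_(j in D) \sum_(k in D :\ j) w j k (gstep k (gstep j x))).
  rewrite mulr_sumr; apply: eq_bigr => j jD; rewrite -mulr_sumr; congr (_ * _).
  under eq_bigr => k _ do rewrite wC.
  by apply/esym/eq_addr_char2; rewrite -big_split IH.
rewrite sum_sym_char2 ?mulr0 // => j k; by rewrite wC gstepC.
Qed.

Definition in_cell D x y :=
  forall i, (x i <= y i <= x i + (i \in D))%N.

Lemma in_cell_refl D x : in_cell D x x.
Proof. by move=> i; rewrite leqnn leq_addr. Qed.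

Lemma in_cell_gstep D j x y : j \in D ->
  in_cell (D :\ j) (gstep j x) y -> in_cell D x y.
Proof.
move=> jD H i; have /andP[h1 h2] := H i; apply/andP; split.
  by apply: leq_trans h1; rewrite leq_addr.
apply: leq_trans h2 _; rewrite /gstep !inE.
by case: (eqVneq i j) => [->|_]; rewrite ?jD ?addn0 //=.
Qed.

(** The corners visited by [cup] never leave the cube, so the factor that belongs to [i] is a sum of
    two equal values of [u i]. *)
Lemma cup_eq0 us D x i : i \in us ->
  (forall y z, in_cell D x y -> in_cell D x z -> u i y = u i z) ->
  cup us D x = 0.
Proof.
elim: us D x => [//|k us IH] D x /=; rewrite inE => /orP[/eqP <-|ius] uc.
  rewrite big1 // => j jD; rewrite (uc (gstep j x) x) ?addrr_char2 ?mul0r //.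
    exact/(in_cell_gstep jD)/in_cell_refl.
  exact: in_cell_refl.
rewrite big1 // => j jD; rewrite IH ?mulr0 // => y z Hy Hz.
by apply: uc; apply: (in_cell_gstep jD).
Qed.

Section Box.
Variable m : nat.

(** Coordinates outside [s] stay frozen at their values in [x], so the same operation sums over a
    box and over its facets. *)
Fixpoint boxsum (s : seq 'I_n) (f : ('I_n -> nat) -> F) x : F :=
  if s is d :: s' then \sum_(c < m) boxsum s' f (gset d c x) else f x.

Lemma eq_boxsum s f g x : f =1 g -> boxsum s f x = boxsum s g x.
Proof. by move=> FG; elim: s x => //= d s IH x; apply: eq_bigr. Qed.

Lemma boxsumD s f g x :
  boxsum s (fun y => f y + g y) x = boxsum s f x + boxsum s g x.
Proof.
elim: s x => //= d s IH x; rewrite -big_split; apply: eq_bigr => c _ /=.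
exact: IH.
Qed.

Lemma boxsum_sum (I : finType) (P : pred I) s (f : I -> ('I_n -> nat) -> F) x :
  boxsum s (fun y => \sum_(i | P i) f i y) x = \sum_(i | P i) boxsum s (f i) x.
Proof.
elim: s x => //= d s IH x.
under eq_bigr => c _ do rewrite IH.
by rewrite exchange_big.
Qed.

Lemma boxsum_eq0 s f x : (forall y, (forall i, i \notin s -> y i = x i) -> f y = 0) ->
  boxsum s f x = 0.
Proof.
elim: s x => [|d s IH] x H /=; first exact: H.
rewrite big1 // => c _; apply: IH => y Hy; apply: H => i.
rewrite inE negb_or => /andP[id /Hy ->].
by rewrite /gset (negbTE id).
Qed.

Lemma boxsum_neq0 s f x : boxsum s f x != 0 ->
  exists y, [/\ f y != 0, forall i, i \in s -> (y i < m)%N &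
    forall i, i \notin s -> y i = x i].
Proof.
elim: s x => [|d s IH] x /=; first by exists x.
move=> Fs; have [c /IH[y [Fy ys yns]]] :
    exists c : 'I_m, boxsum s f (gset d c x) != 0.
  apply/existsP; apply: contraNT Fs => /existsPn H.
  by rewrite big1 // => c _; apply/eqP; rewrite -[_ == _]negbK H.
exists y; split=> // i; rewrite inE.
  case: (boolP (i \in s)) => [/ys//|/yns ->]; rewrite orbF => /eqP ->.
  by rewrite /gset eqxx.
by rewrite negb_or => /andP[id /yns ->]; rewrite /gset (negbTE id).
Qed.

Lemma boxsum_gstep s j f x : j \notin s ->
  boxsum s (fun y => f (gstep j y)) x = boxsum s f (gstep j x).
Proof.
elim: s x => //= d s IH x; rewrite inE negb_or => /andP[jd js].
by apply: eq_bigr => c _; rewrite IH // gstep_gsetC.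
Qed.

Lemma boxsum_rem s j f x : j \in s ->
  boxsum s f x = \sum_(c < m) boxsum (rem j s) f (gset j c x).
Proof.
elim: s x => //= d s IH x; rewrite inE eq_sym; case: eqVneq => [->//|dj] /= js.
under eq_bigr => c _ do rewrite IH //.
rewrite exchange_big /=; apply: eq_bigr => c _.
by apply: eq_bigr => e _; rewrite gsetC // eq_sym.
Qed.

(** Every inner slice orthogonal to [j] occurs twice and cancels; the two outermost slices
    remain. *)
Lemma boxsum_telescope s j f x : uniq s -> j \in s ->
  boxsum s (fun y => f (gstep j y) + f y) x =
  boxsum (rem j s) f (gset j m x) + boxsum (rem j s) f (gset j 0 x).
Proof.
move=> us js; rewrite (boxsum_rem _ _ js).
have jr : j \notin rem j s by rewrite mem_rem_uniq // inE eqxx.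
under eq_bigr => c _ do rewrite boxsumD boxsum_gstep // gstep_gset.
elim: (m) => [|k IH]; first by rewrite big_ord0 addrr_char2.
rewrite big_ord_recr /= IH.
by rewrite (addrC (boxsum _ _ (gset j k x))) addrACA addrr_char2 addr0 addrC.
Qed.

(* [cup (i :: us)] is the coboundary of [u i * cup us], so its sum over a box
   only sees the facets of the box. *)
Lemma cup_stokes s D i us x : uniq s -> D =i s ->
  boxsum s (cup (i :: us) D) x =
  \sum_(j in D) (boxsum (rem j s) (fun y => u i y * cup us (D :\ j) y) (gset j m x) +
                  boxsum (rem j s) (fun y => u i y * cup us (D :\ j) y) (gset j 0 x)).
Proof.
move=> us_ Ds.
transitivity (boxsum s (fun y => \sum_(j in D)
   (u i (gstep j y) * cup us (D :\ j) (gstep j y) + u i y * cup us (D :\ j) y)) x).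
  apply: eq_boxsum => y /=; apply: eq_addr_char2; rewrite -big_split /=.
  (* Leibniz rule: the two integrands differ by [u i y] times the coboundary of [cup us], which is
     zero by [cup_closed]. *)
  transitivity (u i y * 0); last exact: mulr0.
  rewrite -[X in _ * X](cup_closed us D y) mulr_sumr.
  by apply: eq_bigr => j jD; rewrite mulrDl mulrDr addrACA addrr_char2 add0r.
rewrite boxsum_sum; apply: eq_bigr => j jD.
by rewrite boxsum_telescope // -Ds.
Qed.

Hypothesis u0 : forall i x, x i = 0%N -> u i x = 0.
Hypothesis um : forall i x, x i = m -> u i x = 1.

(* On a facet orthogonal to a direction other than the first one, some
   remaining label is constant and the cup product vanishes; of the two facets
   orthogonal to the first direction, only [x i = m] has a nonzero weight. *)
Lemma boxsum_cup s x : uniq s -> boxsum s (cup s [set i in s]) x = 1.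
Proof.
elim: s x => [//|i s IH] x us.
have /andP[ins us'] := us.
rewrite cup_stokes //; last by move=> j; rewrite inE.
have inE' j : (j \in [set i0 in i :: s]) = (j \in i :: s) by rewrite inE.
rewrite (bigD1 i) ?inE' ?mem_head //= eqxx.
have -> : [set i0 in i :: s] :\ i = [set i0 in s].
  by apply/setP => j; rewrite !inE; case: eqVneq => //= ->; rewrite (negbTE ins).
rewrite [X in _ + X + _]boxsum_eq0 ?addr0; last first.
  by move=> y /(_ _ ins) yi; rewrite u0 ?mul0r // yi /gset eqxx.
rewrite big1 ?addr0; last first.
  move=> j /andP[]; rewrite inE' inE => /orP[->//|js] ji.
  have jr : j \notin i :: rem j s.
    by rewrite inE negb_or ji mem_rem_uniq // inE eqxx.
  have cup0 c y : (c = 0 \/ c = m)%N ->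
      (forall k, k \notin i :: rem j s -> y k = gset j c x k) ->
      u i y * cup s ([set i0 in i :: s] :\ j) y = 0.
    move=> cE /(_ _ jr) yj; rewrite (cup_eq0 js) ?mulr0 // => z w zc wc.
    have zj v : in_cell ([set i0 in i :: s] :\ j) y v -> v j = c.
      move=> /(_ j); rewrite !inE eqxx addn0 -eqn_leq => /eqP <-.
      by rewrite yj /gset eqxx.
    by case: cE => cE; subst c; rewrite ?(u0 (zj _ zc)) ?(u0 (zj _ wc)) //
      (um (zj _ zc)) (um (zj _ wc)).
  rewrite eq_sym (negbTE ji) !boxsum_eq0 ?addr0 // => y; apply: cup0; by [left|right].
transitivity (boxsum s (cup s [set i0 in s]) (gset i m x)); last exact: IH.
apply: eq_addr_char2; rewrite -boxsumD boxsum_eq0 // => y /(_ _ ins) yi.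
by rewrite um ?mul1r ?addrr_char2 // yi /gset eqxx.
Qed.

(** As the total is 1, some unit cube has a nonzero cup product, and by [cup_eq0] no label is
    constant on it. *)
Lemma cup_cell : exists x, (forall i, (x i < m)%N) /\
  forall i, exists y z, [/\ in_cell finset.setT x y, in_cell finset.setT x z & u i y <> u i z].
Proof.
have /eqP := boxsum_cup (fun=> 0) (enum_uniq 'I_n).
set b := boxsum _ _ _ => /eqP b1; have : b != 0 by rewrite b1 oner_eq0.
move=> /boxsum_neq0[x [Fx xm _]].
exists x; split=> [i|i]; first by rewrite xm // mem_enum.
have TE : [set i0 in enum 'I_n] = finset.setT.
  by apply/setP => j; rewrite !inE mem_enum.
apply: contrapT => H; case/negP: Fx; rewrite TE (@cup_eq0 _ _ _ i) ?mem_enum //.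
by move=> y z cy cz; apply: contrapT => yz; apply: H; exists y, z.
Qed.
End Box.
End Grid.
End CharTwo.

(** With labels read in ['F_2], a label that is not constant on a cube takes both values there. *)
Lemma cubical_sperner n m (l : 'I_n -> ('I_n -> nat) -> bool) :
  (forall i x, x i = 0%N -> l i x = false) ->
  (forall i x, x i = m -> l i x) ->
  exists x, (forall i, (x i < m)%N) /\
  forall i, exists y z, [/\ forall j, (x j <= y j <= (x j).+1)%N,
    forall j, (x j <= z j <= (x j).+1)%N, l i y & ~~ l i z].
Proof.
move=> l0 lm; pose u i x : 'F_2 := (l i x)%:R.
have [|i x /l0|i x /lm|x [xm H]] := @cup_cell _ _ n u m; rewrite /u.
- exact: pchar_Fp.
- by move=> ->.
- by move=> ->.
exists x; split=> // i; have [y [z [cy cz uyz]]] := H i.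
have cell w : in_cell finset.setT x w -> forall j, (x j <= w j <= (x j).+1)%N.
  by move=> cw j; have := cw j; rewrite inE addn1.
move: uyz; rewrite /u; case ly : (l i y); case lz : (l i z) => // _.
  by exists y, z; rewrite ly lz; split=> //; exact: cell.
by exists z, y; rewrite ly lz; split=> //; exact: cell.
Qed.

(** * From grid labels to fixed points of bounded maps *)

Lemma ler_mx_norm_entry (R : realType) n (x : 'rV[R]_n) i : `|x ord0 i| <= `|x|.
Proof.
rewrite [leRHS]/Num.norm /= mx_normrE.
by have := @le_bigmax _ _ _ 0 (fun ij : 'I_1 * 'I_n => `|x ij.1 ij.2|) (ord0, i).
Qed.

Lemma mx_norm_le (R : realType) n (x : 'rV[R]_n) a :
  0 <= a -> (forall i, `|x ord0 i| <= a) -> `|x| <= a.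
Proof.
move=> a0 xa; rewrite [leLHS]/Num.norm /= mx_normrE.
by apply/bigmax_leP; split=> // -[i j] _ /=; rewrite ord1.
Qed.

Lemma within_continuous_distP (R : realType) (V W : normedModType R) (A : set V)
    (f : V -> W) :
  {within A, continuous f} <->
  forall x, A x -> forall e, 0 < e -> exists2 d, 0 < d &
    forall y, A y -> `|x - y| < d -> `|f x - f y| < e.
Proof.
rewrite subspace_continuousP; split=> H x Ax.
  move=> e e0; have /cvgrPdist_lt/(_ e e0) := H x Ax.
  by move=> /nbhs_ballP[d /= d0 dP]; exists d => // y Ay xy; apply: (dP y _ Ay); rewrite -ball_normE.
apply/cvgrPdist_lt => e /(H x Ax)[d d0 dP].
by apply/nbhs_ballP; exists d => // y; rewrite -ball_normE => xy Ay; apply: dP.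
Qed.

Lemma within_continuous_comp_sub (R : realType) (U V W : normedModType R)
    (A : set U) (B : set V) (f : U -> V) (g : V -> W) :
  (forall x, A x -> B (f x)) ->
  {within A, continuous f} -> {within B, continuous g} ->
  {within A, continuous (fun x => g (f x))}.
Proof.
move=> AB /within_continuous_distP cf /within_continuous_distP cg.
apply/within_continuous_distP => x Ax e e0.
have [d d0 dP] := cg _ (AB _ Ax) _ e0; have [c c0 cP] := cf _ Ax _ d0.
by exists c => // y Ay xy; apply: dP; [exact: AB|exact: cP].
Qed.

Section Brouwer.
Variable R : realType.

(** Label [i] records whether [phi] fails to increase coordinate [i]. A cell with both values of
    every label has its lower corner within one mesh width of points of either kind. *)
Lemma grid_almost_fixed n (phi : 'rV[R]_n -> 'rV[R]_n) (a : R) (m : nat) :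
  0 < a -> (forall x, `|phi x| <= a) -> (0 < m)%N ->
  exists2 p : 'rV[R]_n, `|p| <= a & forall i, exists y z,
    [/\ `|p - y| <= 2 * a / m%:R, `|p - z| <= 2 * a / m%:R,
       phi y ord0 i <= y ord0 i & z ord0 i <= phi z ord0 i].
Proof.
move=> a0 phia m0; have m0' : 0 < m%:R :> R by rewrite ltr0n.
pose P (x : 'I_n -> nat) : 'rV[R]_n := \row_i (2 * a / m%:R * (x i)%:R - a).
(* The labels where [x i] is 0 or [m] are forced. This is harmless: coordinate [i] of [P x] is then
   [- a] or [a], and the bound on [phi] yields the desired inequality. *)
pose l i x := (x i != 0%N) && ((x i == m) || (phi (P x) ord0 i <= P x ord0 i)).
have phiP x i : - a <= phi x ord0 i <= a.
  by rewrite -ler_norml (le_trans (ler_mx_norm_entry _ _)).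
have [i x xi|i x xi|x [xm H]] := @cubical_sperner n m l.
- by rewrite /l xi eqxx.
- by rewrite /l xi eqxx -lt0n m0.
have close y : (forall j, (x j <= y j <= (x j).+1)%N) -> `|P x - P y| <= 2 * a / m%:R.
  move=> xy; apply: mx_norm_le; first by rewrite divr_ge0 ?mulr_ge0 ?ltW.
  move=> i; rewrite !mxE opprD addrACA subrr addr0 -mulrBr normrM.
  rewrite (@ger0_norm _ (2 * a / m%:R)); last by rewrite divr_ge0 ?mulr_ge0 ?ltW.
  rewrite ler_piMr //; first by rewrite divr_ge0 ?mulr_ge0 ?ltW.
  have /andP[h1 h2] := xy i.
  rewrite distrC ger0_norm ?subr_ge0 ?ler_nat // -natrB // -[leRHS]/(1%:R) ler_nat.
  by rewrite leq_subLR addn1.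
exists (P x).
  apply: mx_norm_le; first exact: ltW.
  move=> i; rewrite mxE ler_norml; apply/andP; split.
    by rewrite lerBrDr addrC subrr mulr_ge0 // divr_ge0 ?mulr_ge0 ?ltW.
  have : 2 * a / m%:R * (x i)%:R <= 2 * a; last by lra.
  have a2 : 0 <= 2 * a by rewrite mulr_ge0 // ltW.
  rewrite -mulrA ler_piMr // mulrC ler_pdivrMr // mul1r ler_nat.
  exact: ltnW.
move=> i; have [y [z [/close xy /close xz ly lz]]] := H i.
exists (P y), (P z); split=> //.
  move: ly; rewrite /l => /andP[_ /orP[/eqP yi|//]].
  rewrite [leRHS]mxE yi mulfVK ?gt_eqF //; have /andP[_] := phiP (P y) i; lra.
move: lz; rewrite /l negb_and negbK => /orP[/eqP zi|].
  rewrite [leLHS]mxE zi mulr0 sub0r; by have /andP[] := phiP (P z) i.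
by rewrite negb_or -ltNge => /andP[_ /ltW].
Qed.

(** A cluster point [q] of almost fixed points of ever finer grids is fixed: a nonzero coordinate of
    [phi q - q] would keep its sign near [q], where both weak signs occur. *)
Lemma brouwer_bounded n (phi : 'rV[R]_n -> 'rV[R]_n) (a : R) :
  0 < a -> continuous phi -> (forall x, `|phi x| <= a) ->
  exists x, phi x = x.
Proof.
move=> a0 cphi phia.
have /choice[p Hp] m : exists p : 'rV[R]_n, `|p| <= a /\ forall i, exists y z,
    [/\ `|p - y| <= 2 * a / m.+1%:R, `|p - z| <= 2 * a / m.+1%:R,
       phi y ord0 i <= y ord0 i & z ord0 i <= phi z ord0 i].
  by have [//|p pa pP] := @grid_almost_fixed n phi a m.+1 a0 phia; exists p.
pose K : set 'rV[R]_n := [set x | `|x| <= a].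
have cK : compact K.
  apply: bounded_closed_compact.
    by exists a; split=> [|M aM x /= xa]; [exact: num_real|rewrite (le_trans xa) // ltW].
  apply: (@closed_comp _ _ (fun x : 'rV[R]_n => `|x|) [set y | y <= a]).
    by move=> x _; exact: norm_continuous.
  exact: closed_le.
have [q [_ clq]] : K `&` cluster (p @ \oo) !=set0.
  by apply: cK; exists 0%N => // m _; have [] := Hp m.
exists q; apply/rowP => i.
pose g (x : 'rV[R]_n) := phi x ord0 i - x ord0 i.
have cg : continuous g.
  move=> x; apply: (@continuousB _ R^o _ (fun z => phi z ord0 i) (fun z => z ord0 i)).
    apply: (@continuous_comp _ _ _ phi (fun M : 'rV[R]_n => M ord0 i)).
      exact: cphi.
    exact: coord_continuous.
  exact: coord_continuous.
(* Half of [e] is spent on the distance from [q] to [p m], half on the mesh width. *)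
have near_q (Q : set 'rV[R]_n) : nbhs q Q -> exists m, forall y,
    `|p m - y| <= 2 * a / m.+1%:R -> Q y.
  move=> /nbhs_ballP[e /= e0 eQ].
  have [M _ HM] : \forall m \near \oo, 2 * a / m.+1%:R < e / 2.
    have e4 : 0 < e / 2 / (2 * a) by rewrite !divr_gt0 ?mulr_gt0.
    have [M _ HM] := near_infty_natSinv_lt (PosNum e4).
    exists M => // m /HM /=; rewrite ltr_pdivlMr ?mulr_gt0 // mulrC.
    by apply.
  have [_ [[m Mm <-] qm]] : (p @` [set m | (M <= m)%N]) `&` ball q (e / 2) !=set0.
    apply: clq; last by apply: nbhsx_ballx; rewrite divr_gt0.
    by exists M => // m /= Mm; exists m.
  exists m => y pmy; apply: eQ; rewrite -ball_normE /=.
  have := HM m Mm; move: qm; rewrite -ball_normE /= => qm mm.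
  rewrite -(subrKA (p m)) (le_lt_trans (ler_normD _ _)) // [ltRHS]splitr.
  by rewrite ltrD // (le_lt_trans pmy).
apply/eqP; rewrite -subr_eq0 eq_le; apply/andP; split; rewrite leNgt; apply/negP => gq.
  have [m Hm] := near_q _ (cvgr_gt _ (cg q) _ gq).
  have [_ /(_ i) [y [z [/Hm]]]] := Hp m; rewrite /g subr_gt0 => h _ h' _.
  by move: h; rewrite ltNge h'.
have [m Hm] := near_q _ (cvgr_lt _ (cg q) _ gq).
have [_ /(_ i) [y [z [_ /Hm]]]] := Hp m; rewrite /g subr_lt0 => h _ h'.
by move: h; rewrite ltNge h'.
Qed.
End Brouwer.

(** * Euclidean norm and Brouwer's theorem on topological balls *)

Lemma continuous_sum (R : realType) (T : topologicalType) (I : Type) (s : seq I)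
    (f : I -> T -> R) :
  (forall i, continuous (f i)) -> continuous (fun x => \sum_(i <- s) f i x).
Proof.
move=> cf; elim: s => [|i s IH].
  rewrite (_ : (fun _ => _) = fun=> 0); first exact: cst_continuous.
  by apply/funext => x; rewrite big_nil.
rewrite (_ : (fun _ => _) = fun x => f i x + \sum_(j <- s) f j x).
  by move=> x; apply: (@continuousD _ R^o _ (f i) (fun x => \sum_(j <- s) f j x));
    [exact: cf|exact: IH].
by apply/funext => x; rewrite big_cons.
Qed.

Section Euclid.
Variables (R : realType) (n : nat).
Implicit Types (u v x y : 'rV[R]_n).

Lemma enorm_ge0 v : 0 <= enorm v.
Proof. exact: sqrtr_ge0. Qed.

Lemma enormZ (t : R) v : enorm (t *: v) = `|t| * enorm v.
Proof.
rewrite /enorm [edot _ _](_ : _ = t ^+ 2 * edot v v).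
  by rewrite sqrtrM ?sqr_ge0 // sqrtr_sqr.
by rewrite /edot mulr_sumr; apply: eq_bigr => i _; rewrite !mxE; ring.
Qed.

Lemma mx_norm_le_enorm v : `|v| <= enorm v.
Proof.
apply: mx_norm_le => [|i]; first exact: enorm_ge0.
rewrite -sqrtr_sqr ler_wsqrtr // /edot (bigD1 i) //= expr2 lerDl.
by apply: sumr_ge0 => j _; rewrite -expr2 sqr_ge0.
Qed.

(** A crude Cauchy-Schwarz inequality for the max norm, at the cost of the dimension as a factor. *)
Lemma ler_edot u v : `|edot u v| <= n%:R * (`|u| * `|v|).
Proof.
rewrite (le_trans (ler_norm_sum _ _ _)) //.
rewrite (le_trans (ler_sum _ (G := fun=> `|u| * `|v|) _)) //.
  by move=> i _; rewrite normrM ler_pM // ler_mx_norm_entry.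
by rewrite sumr_const card_ord mulr_natl.
Qed.

Lemma edotDl u v y : edot (u + v) y = edot u y + edot v y.
Proof. by rewrite /edot -big_split; apply: eq_bigr => i _; rewrite mxE mulrDl. Qed.

Lemma edotZl t v y : edot (t *: v) y = t * edot v y.
Proof. by rewrite /edot mulr_sumr; apply: eq_bigr => i _; rewrite mxE mulrA. Qed.

Lemma enorm_continuous : continuous (@enorm R n).
Proof.
move=> x; apply: (@continuous_comp _ _ _ (fun v => edot v v) Num.sqrt).
  apply: continuous_sum => i {}x.
  by apply: (@continuousM R _ (fun v : 'rV[R]_n => v ord0 i) (fun v : 'rV[R]_n => v ord0 i));
    exact: coord_continuous.
exact: sqrt_continuous.
Qed.

(** The radial retraction. The maximum merges the cases inside and outside the ball and, for
    [0 < r], keeps the denominator positive. *)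
Definition eretract (c : 'rV[R]_n) (r : R) x :=
  c + (r / Num.max r (enorm (x - c))) *: (x - c).

Lemma eretract_in c r x : 0 < r -> eclosed_ball c r (eretract c r x).
Proof.
move=> r0; rewrite /eclosed_ball /eretract /= addrC addKr enormZ.
have m0 : 0 < Num.max r (enorm (x - c)) by rewrite lt_max r0.
rewrite ger0_norm; last by rewrite divr_ge0 ?ltW.
rewrite mulrAC ler_pdivrMr // ler_pM2l //.
by rewrite le_max lexx orbT.
Qed.

Lemma eretract_id c r x : 0 < r -> eclosed_ball c r x -> eretract c r x = x.
Proof.
move=> r0 xr; rewrite /eretract max_l // divff ?gt_eqF // scale1r.
by rewrite addrC subrK.
Qed.

Lemma eretract_continuous c r : 0 < r -> continuous (eretract c r).
Proof.
move=> r0 x; have m0 y : 0 < Num.max r (enorm (y - c)) by rewrite lt_max r0.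
have cs : continuous (fun y => y - c).
  by move=> y; apply: (@continuousB _ 'rV[R]_n _ id (fun=> c)); [move=> ?|exact: cst_continuous].
apply: (@continuousD _ 'rV[R]_n _ (fun=> c)
   (fun x => (r / Num.max r (enorm (x - c))) *: (x - c))); first exact: cst_continuous.
apply: (@continuousZ _ 'rV[R]_n _ (fun x => r / Num.max r (enorm (x - c))) (fun x => x - c)); last exact: cs.
apply: (@continuousM R _ (fun=> r) (fun x => (Num.max r (enorm (x - c)))^-1)).
  exact: cst_continuous.
apply: (@continuousV _ _ (fun x => Num.max r (enorm (x - c)))); first by rewrite gt_eqF.
apply: (@continuous_max _ _ (fun=> r) (fun x => enorm (x - c))).
  exact: cst_continuous.
apply: (@continuous_comp _ _ _ (fun x => x - c) (@enorm R n)).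
- exact: cs.
- exact: enorm_continuous.
Qed.

(* Precomposition with the radial retraction onto the ball turns the conjugate
   of [phi] into a bounded continuous self-map of the whole space. *)
Lemma brouwer_homeomorphic (K : set 'rV[R]_n) (c : 'rV[R]_n) (r : R)
    (phi : 'rV[R]_n -> 'rV[R]_n) :
  0 < r -> homeomorphic K (eclosed_ball c r) ->
  {within K, continuous phi} -> (forall x, K x -> K (phi x)) ->
  exists x, K x /\ phi x = x.
Proof.
move=> r0 [h [k [[ch ck] hB kK kh hk]]] cphi phiK.
pose psi x := h (phi (k (eretract c r x))).
have Br x : eclosed_ball c r (eretract c r x) by exact: eretract_in.
have psiB x : eclosed_ball c r (psi x) by apply/hB/phiK/kK.
have cpsi : continuous psi.
  apply/continuous_subspace_setT.
  apply: (@within_continuous_comp_sub _ _ _ _ _ (eclosed_ball c r) (eretract c r)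
    (fun y => h (phi (k y)))) => //.
    exact/continuous_subspaceT/eretract_continuous.
  apply: (@within_continuous_comp_sub _ _ _ _ _ K (fun y => phi (k y)) h) => //.
    by move=> x Bx; exact/phiK/kK.
  exact: (@within_continuous_comp_sub _ _ _ _ _ K k phi).
have [||x xpsi] := brouwer_bounded (a := `|c| + r) _ cpsi.
- by rewrite ltr_wpDl.
- move=> x; rewrite -[psi x](subrK c) (le_trans (ler_normD _ _)) // addrC lerD2l.
  by rewrite (le_trans (mx_norm_le_enorm _)) //; exact: psiB.
have xB : eclosed_ball c r x by rewrite -xpsi.
exists (k x); split; first exact: kK.
have : k (psi x) = k x by rewrite xpsi.
by rewrite /psi eretract_id // kh //; apply/phiK/kK.
Qed.
End Euclid.

(** * Limits of approximate periodic orbits *)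

(** Heine-Cantor: half the radius of continuity at [x] for [e / 2] serves all points near [x], and
    the near-covering form of compactness makes it uniform. *)
Lemma compact_within_unif_continuous (R : realType) (V W : normedModType R)
    (A : set V) (f : V -> W) : compact A -> {within A, continuous f} ->
  forall e, 0 < e -> exists2 d, 0 < d &
    forall x y, A x -> A y -> `|x - y| < d -> `|f x - f y| < e.
Proof.
move=> cA /within_continuous_distP cf e e0.
have e2 : 0 < e / 2 by rewrite divr_gt0.
have := (compact_near_coveringP A).1 cA.
move=> /(_ R (0 : R)^'+ (fun d x => A x -> forall y, A y -> `|x - y| < d -> `|f x - f y| < e) _) H.
have : \forall d \near (0:R)^'+, A `<=` (fun x => A x -> forall y, A y -> `|x - y| < d -> `|f x - f y| < e).
  apply: H => x Ax; have [r r0 rP] := cf x Ax _ e2.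
  exists (ball x (r / 2), [set d | d < r / 2]) => /=.
    split; first by apply: nbhsx_ballx; rewrite divr_gt0.
    by apply: nbhs_right_lt; rewrite divr_gt0.
  move=> [z d] /= []; rewrite -ball_normE /= => xz dr Az y Ay zy.
  have h1 : `|f x - f z| < e / 2.
    by apply: rP => //; apply: lt_trans xz _; rewrite ltr_pdivrMr // ltr_pMr // ltr1n.
  have h2 : `|f x - f y| < e / 2.
    apply: rP => //; rewrite -(subrKA z) (le_lt_trans (ler_normD _ _)) //.
    by rewrite [ltRHS]splitr ltrD // (lt_trans zy).
  by rewrite -(subrKA (f x)) (le_lt_trans (ler_normD _ _)) // [ltRHS]splitr distrC ltrD // distrC.
move=> Hd; have [d [d0 dP]] : exists d : R, 0 < d /\ A `<=` (fun x => A x -> forall y, A y -> `|x - y| < d -> `|f x - f y| < e).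
  near (0:R)^'+ => d; exists d; split; last by near: d.
  by near: d; exact: nbhs_right_gt.
by exists d => // x y Ax Ay; apply: dP.
Unshelve. all: by end_near. Qed.

Lemma compact_within_bounded (R : realType) (V W : normedModType R)
    (A : set V) (f : V -> W) : compact A -> {within A, continuous f} ->
  exists2 M, 0 < M & forall x, A x -> `|f x| <= M.
Proof.
move=> cA cf; have [M [_ HM]] := compact_bounded (continuous_compact cf cA).
exists (Num.max 1 (M + 1)); first by rewrite lt_max ltr01.
by move=> x Ax; apply: HM; [rewrite lt_max ltrDl ltr01 orbT|exists x].
Qed.

(** * Error bounds for approximate Euler orbits *)

Section PseudoOrbit.
Variables (R : realType) (V : normedModType R).

(** Each of the [d] steps contributes [h * q] from the defect of the orbit and [h * e] from
    replacing its velocity by [v]. *)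
Lemma pseudo_orbit_dist (x w : nat -> V) (h q e : R) (v : V) j d :
  0 <= h ->
  (forall i, (j <= i < j + d)%N -> `|x i.+1 - x i - h *: w i| <= h * q) ->
  (forall i, (j <= i < j + d)%N -> `|w i - v| <= e) ->
  `|x (j + d)%N - x j - (h *+ d) *: v| <= h *+ d * (e + q).
Proof.
move=> h0; elim: d => [|d IH] Hx Hw.
  by rewrite addn0 subrr mulr0n scale0r mul0r subr0 normr0.
have lt_d : (j <= j + d < j + d.+1)%N by rewrite leq_addr addnS leqnn.
have wid i : (j <= i < j + d)%N -> (j <= i < j + d.+1)%N.
  by move=> /andP[ji id]; rewrite ji addnS ltnS ltnW.
have {}IH := IH (fun i id => Hx i (wid i id)) (fun i id => Hw i (wid i id)).
rewrite addnS (_ : x _ - _ - _ = (x (j + d).+1 - x (j + d)%N - h *: w (j + d)%N) +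
   (h *: w (j + d)%N - h *: v) + (x (j + d)%N - x j - (h *+ d) *: v)).
  rewrite mulrSr mulrDl [leRHS]addrC.
  rewrite (le_trans (ler_normD _ _)) // lerD //.
  rewrite (le_trans (ler_normD _ _)) // mulrDr addrC lerD //; last exact: Hx.
  by rewrite -scalerBr normrZ ger0_norm // ler_wpM2l // Hw.
by rewrite subrKA addrACA subrKA -opprD -scalerDl -mulrS.
Qed.
End PseudoOrbit.

Section Sample.
Variables (R : realType) (V : normedModType R) (T h q M : R) (m : nat) (K : set V)
  (f : R -> V -> V) (x : nat -> V).
Hypotheses (h0 : 0 < h) (q0 : 0 <= q) (mh : m%:R * h = T)
  (Kx : forall i, (i <= m)%N -> K (x i))
  (orbit_x : forall i, (i < m)%N -> `|x i.+1 - x i - h *: f (i%:R * h) (x i)| <= h * q)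
  (fM : forall t z, 0 <= t <= T -> K z -> `|f t z| <= M).

(* A step function rather than a polygon: its jumps are of the order of [h] and
   disappear in the limit, and its values stay in [K]. *)
Definition sample t := x (Num.truncn (t / h)).

Lemma sample_index t : 0 <= t ->
  (Num.truncn (t / h))%:R * h <= t < (Num.truncn (t / h))%:R * h + h.
Proof.
move=> t0; have /truncn_itv/andP[] : 0 <= t / h by rewrite divr_ge0 // ltW.
rewrite ler_pdivlMr // => -> /=; rewrite ltr_pdivrMr // -natr1 mulrDl mul1r.
by [].
Qed.

Lemma sample_index_le t : 0 <= t <= T -> (Num.truncn (t / h) <= m)%N.
Proof.
move=> /andP[t0 tT]; have /andP[jt _] := sample_index t0.
by rewrite -(ler_nat R) -(ler_pM2r h0) mh (le_trans jt).
Qed.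

Lemma sample_in t : 0 <= t <= T -> K (sample t).
Proof. by move=> /sample_index_le /Kx. Qed.

Lemma sample_periodic : x m = x 0%N -> sample 0 = sample T.
Proof.
by move=> xm; rewrite /sample mul0r truncn0 -mh mulfK ?gt_eqF // natrK.
Qed.

Lemma grid_bounds i : (i <= m)%N -> 0 <= i%:R * h <= T.
Proof.
move=> im; rewrite mulr_ge0 ?ler0n ?(ltW h0) //= -mh ler_wpM2r ?ler_nat //.
exact: ltW.
Qed.

Lemma orbit_lipschitz i d : (i + d <= m)%N -> `|x (i + d)%N - x i| <= h *+ d * (M + q).
Proof.
move=> idm; rewrite -[X in `|X|]subr0 -[X in _ - X](scaler0 _ (h *+ d)).
apply: (@pseudo_orbit_dist _ _ x (fun i => f (i%:R * h) (x i))); first exact: ltW.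
  by move=> j /andP[_ jd]; apply: orbit_x; exact: leq_trans idm.
move=> j /andP[_ jd]; have jm : (j <= m)%N by rewrite ltnW // (leq_trans jd).
by rewrite subr0 fM //; [exact: grid_bounds|exact: Kx].
Qed.

(** The steps between [a] and [b] last [b - a] up to an error of [h], which costs [h * M]. The index
    [i0] may be at either end, so that forward and backward increments are both covered. *)
Lemma sample_increment (e d a b s : R) (i0 : nat) :
  0 <= a -> a <= b -> b <= T -> a <= s <= b ->
  (Num.truncn (a / h) <= i0 <= Num.truncn (b / h))%N ->
  b - a + h < d -> (b - a + h) * (M + q) < d ->
  0 <= M -> 0 <= e ->
  (forall t t' z z', 0 <= t <= T -> 0 <= t' <= T -> K z -> K z' ->
     `|t - t'| < d -> `|z - z'| < d -> `|f t z - f t' z'| <= e) ->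
  `|sample b - sample a - (b - a) *: f s (x i0)| <= (b - a + h) * (e + q) + h * M.
Proof.
move=> a0 ab bT /andP[as_ sb] /andP[ji0 i0k] d1 d2 M0 e0 fe.
have b0 : 0 <= b by exact: le_trans ab.
have /andP[ja aj] := sample_index a0; have /andP[kb bk] := sample_index b0.
have km : (Num.truncn (b / h) <= m)%N by apply: sample_index_le; rewrite b0.
rewrite /sample; set j := Num.truncn (a / h) in ja aj ji0 *.
set k := Num.truncn (b / h) in kb bk i0k km *.
have jk : (j <= k)%N by exact: leq_trans i0k.
have len : h *+ (k - j) <= b - a + h.
  by rewrite -mulr_natl natrB // mulrBl; lra.
have len' : `|h *+ (k - j) - (b - a)| <= h.
  by rewrite -mulr_natl natrB // mulrBl ler_norml; apply/andP; split; lra.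
have near_i0 i : (j <= i <= k)%N -> `|x i - x i0| < d.
  move=> /andP[ji ik]; apply: le_lt_trans d2.
  have [i0i|ii0] := leqP i0 i.
    rewrite -(subnKC i0i) (le_trans (orbit_lipschitz _)) ?subnKC ?(leq_trans ik) //.
    rewrite ler_wpM2r ?addr_ge0 // (le_trans _ len) // ler_wpMn2l ?(ltW h0) //.
    by rewrite leq_sub.
  rewrite distrC -(subnKC (ltnW ii0)) (le_trans (orbit_lipschitz _)) ?subnKC ?(ltnW ii0) ?(leq_trans i0k) //.
  rewrite ler_wpM2r ?addr_ge0 // (le_trans _ len) // ler_wpMn2l ?(ltW h0) //.
  by rewrite leq_sub.
have sT : 0 <= s <= T by rewrite (le_trans a0) //= (le_trans sb).
have i0m : (i0 <= m)%N by exact: leq_trans km.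
have main : `|x k - x j - (h *+ (k - j)) *: f s (x i0)| <= h *+ (k - j) * (e + q).
  rewrite -{1}(subnKC jk).
  apply: (@pseudo_orbit_dist _ _ x (fun i => f (i%:R * h) (x i))); first exact: ltW.
    by rewrite subnKC // => i /andP[_ ik]; apply: orbit_x; exact: leq_trans km.
  rewrite subnKC // => i /andP[ji ik].
  have im : (i <= m)%N by rewrite ltnW // (leq_trans ik).
  apply: fe => //; [exact: grid_bounds|exact: Kx|exact: Kx| |].
    apply: le_lt_trans d1.
    have jih : j%:R * h <= i%:R * h by rewrite ler_pM2r // ler_nat.
    have ikh : i%:R * h <= k%:R * h by rewrite ler_pM2r // ler_nat ltnW.
    by rewrite ler_norml; apply/andP; split; lra.
  by apply: near_i0; rewrite ji ltnW.
rewrite (_ : _ - _ - _ = (x k - x j - (h *+ (k - j)) *: f s (x i0)) +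
   (h *+ (k - j) - (b - a)) *: f s (x i0)); last by rewrite [X in _ = _ + X]scalerBl subrKA.
rewrite (le_trans (ler_normD _ _)) // lerD //.
  by rewrite (le_trans main) // ler_wpM2r // addr_ge0.
by rewrite normrZ ler_pM // fM //; exact: Kx.
Qed.

Lemma sample_estimate (e d s t : R) :
  0 <= s <= T -> 0 <= t <= T ->
  `|t - s| + h < d -> (`|t - s| + h) * (M + q) < d ->
  0 <= M -> 0 <= e ->
  (forall t t' z z', 0 <= t <= T -> 0 <= t' <= T -> K z -> K z' ->
     `|t - t'| < d -> `|z - z'| < d -> `|f t z - f t' z'| <= e) ->
  `|sample t - sample s - (t - s) *: f s (sample s)| <=
    (`|t - s| + h) * (e + q) + h * M.
Proof.
move=> /andP[s0 sT] /andP[t0 tT] d1 d2 M0 e0 fe.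
have mono a b : 0 <= a -> a <= b -> (Num.truncn (a / h) <= Num.truncn (b / h))%N.
  by move=> a0 ab; rewrite le_truncn // ler_wpM2r // invr_ge0 ltW.
have [st|/ltW ts] := leP s t.
  move: d1 d2; rewrite ger0_norm ?subr_ge0 // => d1 d2.
  by apply: (@sample_increment e d) => //; rewrite ?lexx ?leqnn ?mono.
move: d1 d2; rewrite ler0_norm ?subr_le0 // opprB => d1 d2.
rewrite -normrN [X in `|X|](_ : _ = sample s - sample t - (s - t) *: f s (sample s)).
  by apply: (@sample_increment e d) => //; rewrite ?lexx ?leqnn ?mono ?ts.
by rewrite -[X in _ = _ + X]scaleNr !opprB addrC.
Qed.
End Sample.

(** Compactness gives a cluster point of the image of [U], and an ultrafilter converges to each of
    its cluster points. *)
Lemma ultra_compact_cvg (I : Type) (X : topologicalType) (U : set_system I)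
    (K : set X) (g : I -> X) : UltraFilter U -> compact K -> U (g @^-1` K) ->
  exists2 z, K z & g @ U --> z.
Proof.
move=> UU cK UK; have [z [Kz clz]] := cK (g @ U) _ UK.
exists z => // P Pz; have [//|UP] := in_ultra_setVsetC (g @^-1` P) UU.
by have [x [nPx Px]] := clz (~` P) P UP Pz.
Qed.

Section Limit.
Variables (R : realType) (N : nat) (T : R) (Omega K : set 'rV[R]_N)
  (f : R -> 'rV[R]_N -> 'rV[R]_N).

(* Pointwise limits along one ultrafilter on [nat] replace the Arzela-Ascoli
   theorem, and the difference quotient estimate [est] passes to the limit, so
   no integral equation is needed. *)
Lemma periodic_limit :
  0 < T -> compact K -> K `<=` Omega ->
  {within `[0, T]%classic `*` K, continuous (fun p : R * 'rV[R]_N => f p.1 p.2)} ->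
  (forall n : nat, exists (m : nat) (x : nat -> 'rV[R]_N),
     [/\ (n < m)%N, forall i, (i <= m)%N -> K (x i), x m = x 0%N &
       forall i, (i < m)%N ->
         `|x i.+1 - x i - (T / m%:R) *: f (i%:R * (T / m%:R)) (x i)|
           <= T / m%:R * n.+1%:R^-1]) ->
  exists y, is_periodic_solution_in T Omega f K y.
Proof.
move=> T0 cK KO cf orb.
have cD : compact (`[0, T]%classic `*` K) by apply: compact_setX => //; exact: segment_compact.
have [M M0 fM'] := compact_within_bounded cD cf.
have DE t z : 0 <= t <= T -> K z -> (`[0, T]%classic `*` K) (t, z).
  by move=> tT Kz; split=> //=; rewrite in_itv.
have fM t z : 0 <= t <= T -> K z -> `|f t z| <= M.
  by move=> tT Kz; apply: (fM' (t, z)); exact: DE.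
have uc e : 0 < e -> exists2 d, 0 < d & forall t t' z z', 0 <= t <= T -> 0 <= t' <= T ->
    K z -> K z' -> `|t - t'| < d -> `|z - z'| < d -> `|f t z - f t' z'| <= e.
  move=> e0; have [d d0 dP] := compact_within_unif_continuous cD cf e0.
  exists d => // t t' z z' tT tT' Kz Kz' tt' zz'.
  apply/ltW/(dP (t, z) (t', z')); [exact: DE|exact: DE|].
  by rewrite prod_normE /= gt_max tt' zz'.
have /choice[mx orbP] : forall n, exists p : nat * (nat -> 'rV[R]_N),
     [/\ (n < p.1)%N, forall i, (i <= p.1)%N -> K (p.2 i), p.2 p.1 = p.2 0%N &
       forall i, (i < p.1)%N ->
         `|p.2 i.+1 - p.2 i - (T / p.1%:R) *: f (i%:R * (T / p.1%:R)) (p.2 i)|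
           <= T / p.1%:R * n.+1%:R^-1].
  by move=> n; have [m [x H]] := orb n; exists (m, x).
pose h n := T / (mx n).1%:R; pose k n : R := n.+1%:R^-1.
have m0 n : 0 < (mx n).1%:R :> R.
  by have [nm _ _ _] := orbP n; rewrite ltr0n (leq_ltn_trans _ nm).
have h0 n : 0 < h n by rewrite divr_gt0.
have k0 n : 0 < k n by rewrite invr_gt0 ltr0n.
have k1 n : k n <= 1 by rewrite invf_le1 ?ltr0n // ler1n.
have hk n : h n <= T * k n.
  have [nm _ _ _] := orbP n.
  by rewrite ler_pM2l // lef_pV2 ?posrE ?m0 ?ltr0Sn // ler_nat.
have mh n : (mx n).1%:R * h n = T by rewrite mulrC divfK // gt_eqF.
pose y_ n t := sample (h n) (mx n).2 t.
have Ky n t : 0 <= t <= T -> K (y_ n t).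
  by have [_ Kx _ _] := orbP n; apply: (sample_in (h0 n) (mh n) Kx).
have yper n : y_ n 0 = y_ n T.
  by have [_ _ xm _] := orbP n; apply: (sample_periodic (h0 n) (mh n) xm).
have est e : 0 < e -> exists2 d, 0 < d & forall s t, 0 <= s <= T -> 0 <= t <= T ->
    `|t - s| < d -> forall eta, 0 < eta -> \forall n \near \oo,
    `|y_ n t - y_ n s - (t - s) *: f s (y_ n s)| <= `|t - s| * e + eta.
  move=> e0; have [d d0 dP] := uc e e0.
  have M1 : 0 < M + 1 by rewrite addr_gt0.
  (* Since [k n <= 1], the bound [|t - s| + h n < d' * 2] keeps the orbit within [d] of its value at
     time [s]. *)
  pose d' := d / (M + 1) / 2; have d'0 : 0 < d' by rewrite !divr_gt0.
  exists d' => // s t sT tT ts eta eta0.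
  (* By [h n <= T * k n], the error of [sample_estimate] exceeds [|t - s| * e] by at most
     [k n * (T * (2 + e + M))]. *)
  have T2 : 0 < T * (2 + e + M) by rewrite mulr_gt0 // !addr_gt0.
  have near1 : \forall n \near \oo, k n < eta / (T * (2 + e + M)).
    by apply: (near_infty_natSinv_lt (PosNum (divr_gt0 eta0 T2))).
  have near2 : \forall n \near \oo, k n < d' / T.
    by apply: (near_infty_natSinv_lt (PosNum (divr_gt0 d'0 T0))).
  apply: filterS2 near1 near2 => n; rewrite ltr_pdivlMr // => n1.
  rewrite ltr_pdivlMr // => n2.
  have hd : h n < d' by rewrite (le_lt_trans (hk n)) // mulrC.
  have dd : d' * 2 * (M + 1) = d.
    by rewrite /d' mulfVK ?pnatr_eq0 // mulfVK // gt_eqF.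
  have [nm Kx xm ox] := orbP n.
  have sum_d : `|t - s| + h n < d' * 2 by rewrite mulr_natr mulr2n ltrD.
  have dM : d' * 2 <= d.
    have d2 : 0 <= d' * 2 by rewrite mulr_ge0 // ltW.
    by rewrite -[leRHS]dd ler_peMr // lerDr ltW.
  apply: (le_trans (@sample_estimate _ _ T (h n) (k n) M (mx n).1 K f (mx n).2
    (h0 n) (ltW (k0 n)) (mh n) Kx ox fM e d s t sT tT _ _ (ltW M0) (ltW e0) dP)).
  - exact: lt_le_trans dM.
  - rewrite -[ltRHS]dd; apply: (@le_lt_trans _ _ ((`|t - s| + h n) * (M + 1))).
      by rewrite ler_wpM2l ?addr_ge0 ?(ltW (h0 n)) // lerD2l.
    by rewrite ltr_pM2r.
  - have tsT : `|t - s| <= T.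
      by rewrite ler_norml; move: sT tT => /andP[? ?] /andP[? ?]; apply/andP; split; lra.
    have a1 : `|t - s| * k n <= T * k n by rewrite ler_pM2r.
    have a2 : h n * k n <= T * k n by rewrite (le_trans _ (hk n)) // ler_piMr // ltW.
    have a3 : h n * e <= T * k n * e by rewrite ler_pM2r.
    have a4 : h n * M <= T * k n * M by rewrite ler_pM2r.
    nra.
have [U [UU ooU]] : exists U : set_system nat, UltraFilter U /\ \oo `<=` U.
  exact: ultraFilterLemma.
have UF : ProperFilter U by exact: ultra_proper.
have /choice[y yP] : forall t, exists z, 0 <= t <= T -> K z /\ y_ n t @[n --> U] --> z.
  (* Outside [[0, T]] nothing is asked of the limit, and 0 is a dummy witness. *)
  move=> t; have [tT|] := boolP (0 <= t <= T); last by exists 0.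
  have [|z Kz yz] := ultra_compact_cvg (g := y_ ^~ t) UU cK; last by exists z.
  by apply: filterE => n; exact: Ky.
exists y.
have yin t : 0 <= t <= T -> K (y t) by move=> /yP[].
have inE t : `[0, T]%classic t -> 0 <= t <= T by rewrite /= in_itv.
have fcv s : 0 <= s <= T -> f s (y_ n s) @[n --> U] --> f s (y s).
  move=> sT; have [Ks ys] := yP _ sT.
  apply/cvgrPdist_le => e /uc[d d0 dP].
  have : \forall n \near U, `|y s - y_ n s| < d by move/cvgrPdist_lt : ys; apply.
  by apply: filterS => n yn; apply: dP => //; [exact: Ky|rewrite subrr normr0].
split.
- move=> s /inE sT; split; first exact/KO/yin.
  apply/cvgrPdist_lt => e e0; have e2 : 0 < e / 2 by rewrite divr_gt0.
  have [d d0 dP] := est _ e2.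
  (* In the limit along [U] the arbitrary [eta] drops out; the remaining bound, linear in [|t - s|],
     gives the derivative at [s]. *)
  have lim t : 0 <= t <= T -> `|t - s| < d ->
      `|y t - y s - (t - s) *: f s (y s)| <= `|t - s| * (e / 2).
    move=> tT ts; apply/ler_addgt0Pr => eta eta0.
    have cv : `|y_ n t - y_ n s - (t - s) *: f s (y_ n s)| @[n --> U] -->
        `|y t - y s - (t - s) *: f s (y s)|.
      apply: cvg_norm; apply: cvgB; last by apply: cvgZ; [exact: cvg_cst|exact: fcv].
      by apply: cvgB; [have [] := yP _ tT|have [] := yP _ sT].
    apply: (cvgr_to_le cv); apply: ooU.
    exact: dP.
  apply/nbhs_ballP; exists d => //= t; rewrite -ball_normE /= => st ts /inE tT.
  have tsn : 0 < `|t - s| by rewrite normr_gt0 subr_eq0.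
  rewrite (_ : _ - _ = - ((t - s)^-1 *: (y t - y s - (t - s) *: f s (y s)))); last first.
    by rewrite [X in _ = - X]scalerBr scalerA mulVf ?subr_eq0 // scale1r opprB.
  rewrite normrN normrZ normfV mulrC ltr_pdivrMr // (le_lt_trans (lim t tT _)) //.
    by rewrite distrC.
  by rewrite mulrC ltr_pM2r // ltr_pdivrMr // ltr_pMr // ltr1n.
- have [|_ c0] := yP 0; first by rewrite lexx ltW.
  have [|_] := yP T; first by rewrite lexx ltW.
  rewrite -(_ : y_ ^~ 0 = y_ ^~ T); last by apply/funext => n; exact: yper.
  move=> cT.
  have := @cvg_unique _ (@norm_hausdorff _ 'rV[R]_N) (y_ ^~ 0 @ U) _ _ _ c0 cT.
  exact.
- by move=> t /inE /yin.
Qed.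
End Limit.

(** * Invariance of the closure of G under Euler steps *)

Lemma derive_edot (R : realType) n (V : 'rV[R]_n -> R) (u v : 'rV[R]_n) :
  differentiable V u -> 'D_v V u = edot v (grad V u).
Proof.
move=> dV; rewrite deriveE // {1}(row_sum_delta v) linear_sum.
apply: eq_bigr => i _; by rewrite linearZ /= mxE deriveE.
Qed.

Section Invariance.
Variables (R : realType) (N : nat) (G : set 'rV[R]_N)
  (V : 'rV[R]_N -> 'rV[R]_N -> R).
Hypotheses (oG : open G) (bV : bounding_family G V).

(* At the first exit point [u], the derivative of [V u] along [v] is negative,
   so [V u] is positive just before [u], where the segment is still in [G]. *)
Lemma segment_invariant (x v : 'rV[R]_N) (h : R) : G x ->
  (forall s, 0 <= s <= h -> boundary G (x + s *: v) ->
     edot v (grad (V (x + s *: v)) (x + s *: v)) < 0) ->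
  forall s, 0 <= s <= h -> G (x + s *: v).
Proof.
move=> Gx inward s0 /andP[s00 s0h]; apply: contrapT => nG.
(* The first exit time is [inf S]. As [G] is open, the point reached then lies outside [G]; as [x]
   is in [G], this time is positive and the point is a limit of points of [G]. *)
pose S : set R := [set s | 0 <= s /\ ~ G (x + s *: v)].
have infS : has_inf S by split; [exists s0|exists 0 => s []].
pose s1 := inf S.
have s1_ge0 : 0 <= s1 by apply: lb_le_inf; [exists s0|move=> s []].
have s1h : s1 <= h by apply: le_trans s0h; apply: ge_inf; [exists 0 => s []|].
have before s : 0 <= s -> s < s1 -> G (x + s *: v).
  move=> s_ge0 ss1; apply: contrapT => nGs.
  by move: ss1; rewrite ltNge => /negP; apply; apply: ge_inf; [exists 0 => ? []|].
have cont : continuous (fun s : R => x + s *: v).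
  move=> s; apply: cvgD; first exact: cvg_cst.
  by apply: cvgZ; [exact: cvg_id|exact: cvg_cst].
have near_s1 (Q : set 'rV[R]_N) : nbhs (x + s1 *: v) Q ->
    exists2 d, 0 < d & forall s, `|s - s1| < d -> Q (x + s *: v).
  move=> /(cont s1)/nbhs_ballP[d /= d0 dQ]; exists d => // s ss1.
  by apply: dQ; rewrite -ball_normE /= distrC.
pose u := x + s1 *: v.
have nGu : ~ G u.
  move=> Gu; have [|d d0 dG] := near_s1 G; first exact: open_nbhs_nbhs.
  have [s [s_ge0 nGs] ss1] := inf_adherent d0 infS.
  apply: (nGs); apply: dG; have s1s : s1 <= s by apply: ge_inf; [exists 0 => ? []|].
  by rewrite ger0_norm ?subr_ge0 // ltrBlDl.
have s1_gt0 : 0 < s1.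
  rewrite lt_neqAle s1_ge0 andbT; apply/eqP => s10; apply: nGu.
  by rewrite /u -s10 scale0r addr0.
have bu : boundary G u.
  split; last by move=> /interior_subset.
  move=> B /near_s1[d d0 dB]; pose t := s1 - Num.min s1 (d / 2).
  have m0 : 0 < Num.min s1 (d / 2) by rewrite lt_min s1_gt0 divr_gt0.
  exists (x + t *: v); split.
    by apply: before; rewrite /t ?subr_ge0 ?ge_min ?lexx // ltrBlDr ltrDl.
  apply: dB; rewrite /t addrAC subrr sub0r normrN gtr0_norm // gt_min.
  by rewrite [X in _ || X]ltr_pdivrMr // ltr_pMr // ltr1n orbT.
have [r [r0 [dV _] Vu GV]] := bV bu.
have uu : eball u r u by rewrite /eball /= subrr /enorm /edot big1 ?sqrtr0 // => i _; rewrite mxE mul0r.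
have dVu := dV _ uu.
have D0 : 'D_v (V u) u < 0 by rewrite derive_edot // inward ?s1_ge0.
have cvD : (fun t => t^-1 *: ((V u \o shift u) (t *: v) - V u u)) @ 0^' --> 'D_v (V u) u.
  exact: (diff_derivable dVu).
have [d /= d0 dP] : nbhs_ball (0 : R) [set t | t != 0 ->
    t^-1 *: ((V u \o shift u) (t *: v) - V u u) < 0].
  by apply/nbhs_ballP; exact: (cvgr_lt _ cvD _ D0).
have e0 : 0 < enorm v + 1 by rewrite ltr_wpDl // enorm_ge0.
(* The three bounds keep [s1 - m] nonnegative, the difference quotient at [- m] negative, and the
   point at time [s1 - m] in [eball u r]; the summand 1 covers [v = 0]. *)
pose m := Num.min s1 (Num.min (d / 2) (r / (enorm v + 1))).
have m0 : 0 < m by rewrite !lt_min s1_gt0 !divr_gt0.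
have md : m < d.
  by rewrite !gt_min [X in _ || (X || _)]ltr_pdivrMr // ltr_pMr // ltr1n orbT.
have Em : x + (s1 - m) *: v = - m *: v + u.
  by rewrite scalerBl addrA addrC -scaleNr.
have Gm : G (- m *: v + u).
  by rewrite -Em; apply: before; rewrite ?subr_ge0 ?ge_min ?lexx // ltrBlDr ltrDl.
have [|_] := GV (- m *: v + u).
  split=> //; rewrite /eball /= addrK enormZ normrN gtr0_norm //.
  apply: (@le_lt_trans _ _ (r / (enorm v + 1) * enorm v)).
    by rewrite ler_wpM2r ?enorm_ge0 // !ge_min lexx !orbT.
  by rewrite mulrAC ltr_pdivrMr // ltr_pM2l // ltrDl.
have := dP (- m); rewrite -ball_normE /= sub0r opprK gtr0_norm // => /(_ md).
rewrite oppr_eq0 gt_eqF // => /(_ isT); rewrite Vu subr0 /= /shift /= => h1 h2.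
move: h1; rewrite invrN scaleNr oppr_lt0 /GRing.scale /= pmulr_rgt0 ?invr_gt0 //.
by rewrite ltNge ltW.
Qed.

End Invariance.

(** * Passage to the closure, extension of [g], and Euler's scheme *)

Lemma closure_invariant (R : realType) (V : normedModType R) (A : set V)
    (E : V -> V) : {within closure A, continuous E} ->
  (forall x, A x -> A (E x)) -> forall x, closure A x -> closure A (E x).
Proof.
move=> /within_continuous_distP cE AE x clx B /nbhs_ballP[e /= e0 eB].
have [d d0 dP] := cE x clx e e0.
have [y [Ay xy]] := clx _ (nbhsx_ballx x d d0).
exists (E y); split; first exact: AE.
apply: eB; rewrite -ball_normE; apply: dP; last by rewrite -ball_normE in xy.
exact: subset_closure.
Qed.

(** The scalar extension theorem is applied to each coordinate; compactness supplies the closed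
    domain and the bound. *)
Lemma tietze_rV (R : realType) n (A : set 'rV[R]_n) (g : 'rV[R]_n -> 'rV[R]_n) :
  compact A -> {within A, continuous g} ->
  exists g' : 'rV[R]_n -> 'rV[R]_n, continuous g' /\ {in A, g' =1 g}.
Proof.
move=> cA cg; have [M M0 gM] := compact_within_bounded cA cg.
have clA : closed A by apply: compact_closed => //; exact: norm_hausdorff.
have /choice[G GP] i : exists G : 'rV[R]_n -> R,
    {in A, (fun x => g x ord0 i) =1 G} /\ continuous G.
  have [||G [Gg cG _]] := @continuous_bounded_extension _ R
     (@pseudometric_normal R 'rV[R]_n) A clA (fun x => g x ord0 i) M M0.
  - move=> x; apply: (@continuous_comp _ _ _ (g : subspace A -> _)
      (fun M : 'rV[R]_n => M ord0 i)); first exact: cg.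
    exact: coord_continuous.
  - by move=> x Ax; rewrite (le_trans (ler_mx_norm_entry _ _)) // gM.
  by exists G.
exists (fun x => \row_i G i x); split.
  move=> x; apply/(@cvgrPdist_le _ _ _ (nbhs x)) => e e0.
  have : nbhs x [set y | forall i, `|G i x - G i y| <= e].
    apply: (@filter_forall _ _ (fun i => [set y | `|G i x - G i y| <= e]) (nbhs x)) => i.
    by have [_ /(_ x) /(@cvgrPdist_le _ _ _ (nbhs x))] := GP i; apply.
  apply: (@filterS _ (nbhs x)) => y Hy; apply: mx_norm_le; first exact: ltW.
  by move=> i; rewrite !mxE.
by move=> x xA; apply/rowP => i; rewrite mxE; have [<-] := GP i.
Qed.

Fixpoint euler (R : realType) (V : lmodType R) (F : R -> V -> V) (h : R) (n : nat) (x : V) : V :=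
  if n is i.+1 then euler F h i x + h *: F (i%:R * h) (euler F h i x) else x.

Lemma within_continuous_section (R : realType) (V W : normedModType R)
    (D : set R) (K : set V) (F : R -> V -> W) (t : R) :
  {within D `*` K, continuous (fun p : R * V => F p.1 p.2)} -> D t ->
  {within K, continuous (F t)}.
Proof.
move=> /within_continuous_distP cF Dt; apply/within_continuous_distP => z Kz r r0.
have [b b0 bP] := cF (t, z) (conj Dt Kz) r r0.
exists b => // w Kw zw; apply: (bP (t, w)) => //.
by rewrite prod_normE /= gt_max subrr normr0 b0.
Qed.

Lemma within_continuous_euler_step (R : realType) (V : normedModType R)
    (K : set V) (F : V -> V) (h : R) :
  {within K, continuous F} -> {within K, continuous (fun x => x + h *: F x)}.
Proof.
move=> cF z; apply: (@continuousD _ V (subspace K) id (fun z => h *: F z)).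
  by move: z; apply: continuous_subspaceT => w Q.
by apply: (@continuousZ _ V (subspace K) (fun=> h) F); [exact: cst_continuous|exact: cF].
Qed.

Lemma bounded_closure (R : realType) (V : normedModType R) (A : set V) :
  bounded_set A -> bounded_set (closure A).
Proof.
move=> [M [Mreal AM]]; exists (M + 2); split; first exact: num_real.
move=> b Mb x clx; have [y [Ay]] := clx _ (nbhsx_ballx x 1 ltr01).
rewrite -ball_normE /= => xy; rewrite -(subrK y x) (le_trans (ler_normD _ _)) //.
have My : `|y| <= M + 1 by apply: AM => //; rewrite ltrDl.
by move: xy My Mb; lra.
Qed.

(** The map [euler F h m] is a discrete Poincaré map of [K] into itself, and Brouwer's theorem gives
    it a fixed point. *)
Lemma euler_periodic (R : realType) (N : nat) (K : set 'rV[R]_N) (c : 'rV[R]_N)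
    (r : R) (F : R -> 'rV[R]_N -> 'rV[R]_N) (h : R) (m : nat) :
  0 < r -> homeomorphic K (eclosed_ball c r) ->
  (forall i, (i < m)%N -> {within K, continuous (F (i%:R * h))}) ->
  (forall i x, (i < m)%N -> K x -> K (x + h *: F (i%:R * h) x)) ->
  exists2 x, euler F h m x = x & forall i, (i <= m)%N -> K (euler F h i x).
Proof.
move=> r0 homK cF FK.
have euK i x : (i <= m)%N -> K x -> K (euler F h i x).
  by elim: i => [//|i IH] im Kx /=; apply: FK => //; apply: IH => //; exact: ltnW.
have eucont i : (i <= m)%N -> {within K, continuous (euler F h i)}.
  elim: i => [_|i IH im].
    by apply: continuous_subspaceT => w Q.
  apply: (@within_continuous_comp_sub _ _ _ _ K K (euler F h i)
    (fun x => x + h *: F (i%:R * h) x)).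
  - by move=> x; apply: euK; exact: ltnW.
  - exact/IH/ltnW.
  - exact/within_continuous_euler_step/cF.
have [x [Kx xfix]] := brouwer_homeomorphic r0 homK (eucont m (leqnn m))
  (fun x => @euK m x (leqnn m)).
by exists x => // i im; exact: euK.
Qed.

Section PeriodicOrbit.
Variables (R : realType) (N : nat) (T : R) (G : set 'rV[R]_N)
  (V : 'rV[R]_N -> 'rV[R]_N -> R).
Hypotheses (oG : open G) (cG : compact (closure G))
  (bV : bounding_family G V).

(** A step from [z] keeps the velocity [F t z]. If it meets the boundary at [u], then [F t z] is so
    close to [F t u] that it still points strictly inward there, and [segment_invariant] applies. *)
Lemma euler_step_invariant (F : R -> 'rV[R]_N -> 'rV[R]_N) (c eta : R) :
  0 < c -> 0 < eta ->
  {within `[0, T]%classic `*` closure G, continuous (fun p : R * 'rV[R]_N => F p.1 p.2)} ->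
  (forall u, boundary G u -> enorm (grad (V u) u) <= eta) ->
  (forall u t, boundary G u -> 0 <= t <= T -> edot (F t u) (grad (V u) u) <= - c) ->
  exists2 h0, 0 < h0 & forall h t x, 0 <= h < h0 -> 0 <= t <= T ->
    closure G x -> closure G (x + h *: F t x).
Proof.
move=> c0 eta0 cF gradV inward.
have cD : compact (`[0, T]%classic `*` closure G) by apply: compact_setX => //; exact: segment_compact.
have DE t z : 0 <= t <= T -> closure G z -> (`[0, T]%classic `*` closure G) (t, z).
  by move=> tT Kz; split=> //=; rewrite in_itv.
have [M M0 FM] := compact_within_bounded cD cF.
(* By [ler_edot] the change of velocity costs at most [N * e * eta], which is less than
   [(N + 1) * e * eta = c]. *)
pose e := c / ((N%:R + 1) * eta).
have N1 : 0 < (N%:R + 1) * eta by rewrite mulr_gt0 // ltr_wpDl.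
have e0 : 0 < e by rewrite divr_gt0.
have [d d0 dP] := compact_within_unif_continuous cD cF e0.
exists (d / M); first by rewrite divr_gt0.
move=> h t x /andP[h_ge0]; rewrite ltr_pdivlMr // => hM tT.
have sub z : boundary G z -> closure G z by case.
have inG z : G z -> G (z + h *: F t z).
  move=> Gz; have Kz := subset_closure Gz.
  apply: (segment_invariant oG bV Gz (h := h)); last by rewrite h_ge0 lexx.
  move=> s /andP[s0 sh]; set u := z + s *: F t z => bu.
  have Ft : `|F t z - F t u| < e.
    apply: (dP (t, z) (t, u)); [exact: DE|exact/DE/sub|].
    rewrite prod_normE /= gt_max subrr normr0 d0 /= /u opprD addrA subrr sub0r normrN normrZ ger0_norm //.
    apply: le_lt_trans hM; rewrite ler_pM //.
    exact: (FM (t, z) (DE _ _ tT Kz)).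
  rewrite -(subrK (F t u) (F t z)) edotDl.
  have h1 := inward u t bu tT.
  have h2 : edot (F t z - F t u) (grad (V u) u) <= N%:R * (e * eta).
    rewrite (le_trans (ler_norm _)) // (le_trans (ler_edot _ _)) //.
    rewrite ler_wpM2l // ler_pM //; first exact: ltW.
    by apply: le_trans (gradV _ bu); exact: mx_norm_le_enorm.
  have h3 : (N%:R + 1) * (e * eta) = c.
    by rewrite mulrCA /e divfK // gt_eqF.
  have : 0 < e * eta by rewrite mulr_gt0.
  lra.
have tD : `[0, T]%classic t by rewrite /= in_itv.
(* The segment argument starts from points of [G]; continuity of the step extends invariance to the
   closure. *)
have := within_continuous_euler_step (h := h) (within_continuous_section cF tD).
by move=> /closure_invariant; apply.
Qed.

End PeriodicOrbit.

Theorem theorem3p2 (R : realType) (N : nat) (T : R) (Omega : set 'rV[R]_N)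
    (f : R -> 'rV[R]_N -> 'rV[R]_N) (G : set 'rV[R]_N)
    (V : 'rV[R]_N -> 'rV[R]_N -> R) :
  0 < T ->
  Omega !=set0 -> open Omega ->
  {within `[0, T]%classic `*` Omega,
     continuous (fun p : R * 'rV[R]_N => f p.1 p.2)} ->
  open G -> bounded_set G -> closure G `<=` Omega ->
  bounding_family G V -> nondegenerate_family G V ->
  (forall (u : 'rV[R]_N) (t : R), boundary G u -> `[0, T]%classic t ->
     edot (f t u) (grad (V u) u) <= 0) ->
  (exists g : 'rV[R]_N -> 'rV[R]_N,
     {within boundary G, continuous g} /\
     (ereal_sup [set (edot (g u) (grad (V u) u))%:E | u in boundary G]
        < 0)%E) ->
  (exists (c : 'rV[R]_N) (r : R),
     0 < r /\ homeomorphic (closure G) (eclosed_ball c r)) ->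
  exists y : R -> 'rV[R]_N,
    is_periodic_solution_in T Omega f (closure G) y.
Proof.
move=> T0 _ _ cf oG bG GO bV [eta1 [eta2 [eta10 eta12 gradV]]] fin [g [cg gsup]].
move=> [c [r [r0 homG]]].
have cG : compact (closure G).
  by apply: bounded_closed_compact; [exact: bounded_closure|exact: closed_closure].
have cB : compact (boundary G).
  have -> : boundary G = closure G `&` ~` G by rewrite /boundary (proj1 (interior_id G) oG) setDE.
  by apply: compact_closedI => //; exact: open_closedC.
have [delta delta0 gin] : exists2 delta, 0 < delta &
    forall u, boundary G u -> edot (g u) (grad (V u) u) <= - delta.
  have gle u : boundary G u -> ((edot (g u) (grad (V u) u))%:E <=
      ereal_sup [set (edot (g u) (grad (V u) u))%:E | u in boundary G])%E.
    by move=> bu; apply: ereal_sup_ubound; exists u.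
  case: ereal_sup gle gsup => [s gle|//|gle _].
    rewrite lte_fin => s0; exists (- s); first by rewrite oppr_gt0.
    by move=> u /gle; rewrite lee_fin opprK.
  (* A supremum of minus infinity means that the boundary is empty, so any positive [delta] will
     do. *)
  by exists 1 => // u /gle.
have [g' [cg' g'g]] := tietze_rV cB cg.
have [M M0 g'M] := compact_within_bounded cG (continuous_subspaceT cg').
have cfG : {within `[0, T]%classic `*` closure G,
    continuous (fun p : R * 'rV[R]_N => f p.1 p.2)}.
  by apply: continuous_subspaceW cf => p [pT /GO].
apply: (@periodic_limit _ _ T Omega (closure G) f) => // n.
pose k : R := n.+1%:R^-1; have k0 : 0 < k by rewrite invr_gt0 ltr0n.
(* The factor [k / M] bounds the perturbation by [k] on the closure of [G], so Euler steps for [F]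
   are steps for [f] with the defect allowed by [periodic_limit]. *)
pose F t x := f t x + (k / M) *: g' x.
have kM : 0 < k / M by rewrite divr_gt0.
have cF : {within `[0, T]%classic `*` closure G,
    continuous (fun p : R * 'rV[R]_N => F p.1 p.2)}.
  move=> p; apply: (@continuousD _ 'rV[R]_N (subspace (`[0, T]%classic `*` closure G))
    (fun p : R * 'rV[R]_N => f p.1 p.2) (fun p => (k / M) *: g' p.2)); first exact: cfG.
  move: p; apply: continuous_subspaceT => p.
  apply: (@continuousZ _ 'rV[R]_N _ (fun=> k / M) (fun p : R * 'rV[R]_N => g' p.2)).
    exact: cst_continuous.
  by apply: (@continuous_comp _ _ _ (fun p : R * 'rV[R]_N => p.2) g'); [exact: cvg_snd|exact: cg'].
have eta20 : 0 < eta2 by exact: lt_le_trans eta12.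
have [h0 h00 stepG] : exists2 h0, 0 < h0 & forall h t x, 0 <= h < h0 -> 0 <= t <= T ->
    closure G x -> closure G (x + h *: F t x).
  apply: (euler_step_invariant oG cG bV (F := F) (c := k / M * delta) (eta := eta2)) => //.
  - by rewrite mulr_gt0.
  - by move=> u /gradV[].
  - move=> u t bu tT; rewrite /F edotDl edotZl g'g ?inE // -[leRHS]add0r.
    by rewrite lerD ?fin //= ?in_itv // -mulrN ler_wpM2l ?gin // ltW.
have [m0 _ /(_ _ (leqnn _)) /= m0h] := near_infty_natSinv_lt (PosNum (divr_gt0 h00 T0)).
(* This [m] exceeds [n], as [periodic_limit] demands, and exceeds [m0], so that the step size is
   below [h0]. *)
pose m := (maxn m0 n).+1; pose h := T / m%:R.
have mgt0 : 0 < m%:R :> R by rewrite ltr0n.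
have hgt0 : 0 < h by rewrite divr_gt0.
have hh0 : h < h0.
  rewrite /h mulrC -ltr_pdivlMr //; apply: le_lt_trans m0h.
  by rewrite lef_pV2 ?posrE ?ltr0Sn // ler_nat ltnS leq_maxl.
have grid i : (i < m)%N -> 0 <= i%:R * h <= T.
  move=> im; rewrite mulr_ge0 ?ler0n ?(ltW hgt0) //=.
  have -> : T = m%:R * h by rewrite mulrC divfK // gt_eqF.
  by rewrite ler_pM2r // ler_nat ltnW.
have [|i x im|x xfix Kx] := @euler_periodic R N (closure G) c r F h m r0 homG.
- move=> i im; apply: (within_continuous_section cF).
  by rewrite /= in_itv; exact: grid.
- by apply: stepG; [rewrite hh0 ltW|exact: grid].
exists m, (fun i => euler F h i x); split => //.
- by rewrite ltnS leq_maxr.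
- move=> i im /=; rewrite (addrC (euler F h i x)) addrK /F scalerDr.
  rewrite addrAC subrr add0r.
  rewrite -/h -/k normrZ (normrZ (k / M)) (gtr0_norm hgt0) ler_pM2l // (gtr0_norm kM) mulrAC ler_pdivrMr //.
  by rewrite ler_pM2l // g'M //; apply: Kx; exact: ltnW.
Qed.
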